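(* Assume that $(X,\mathcal{E})$ and $(Y,\mathcal{F})$ are two coarsely equivalent coarse spaces. Then $\operatorname{asDg}_{\mathcal{E}}(X)=\operatorname{asDg}_{\mathcal{F}}(Y)$.
   Context: A coarse structure $\mathcal{E}$ on a nonempty set $X$ is a family of subsets of $X\times X$, closed under taking subsets, such that for all $E,F\in\mathcal{E}$ the sets $E\cup F$, $E^{-1}=\{(y,x)\mid (x,y)\in E\}$ and $E\circ F=\{(x,y)\mid \exists z\in X:\ (x,z)\in F,\ (z,y)\in E\}$ belong to $\mathcal{E}$; then $(X,\mathcal{E})$ is a coarse space. Standing assumption: every coarse structure contains the diagonal $\{(x,x)\mid x\in X\}$ and contains $\{(x,y)\}$ for all $x,y\in X$. A subset $B\subseteq X$ is bounded if $B\times B\in\mathcal{E}$ (in particular the empty set is bounded). For $Y\subseteq X$, the induced coarse structure is $\mathcal{E}_Y=\{E\cap(Y\times Y)\mid E\in\mathcal{E}\}$. A map $f:X\to Y$ between coarse spaces $(X,\mathcal{E})$ and $(Y,\mathcal{F})$ is a coarse map if $(f\times f)(E)\in\mathcal{F}$ for each $E\in\mathcal{E}$ and the inverse image of each bounded subset of $Y$ is a bounded subset of $X$. A coarse map $f:X\to Y$ is a coarse equivalence if there is a coarse map $g:Y\to X$ with $\{(g(f(x)),x)\mid x\in X\}\in\mathcal{E}$ and $\{(f(g(y)),y)\mid y\in Y\}\in\mathcal{F}$; two coarse spaces are coarsely equivalent if there is a coarse equivalence between them. For $E\in\mathcal{E}$ and $A\subseteq X$, $E(A)=\{y\in X\mid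 (y,x)\in E\text{ for some }x\in A\}$; $A\lambda_{\mathcal{E}}B$ means $A\subseteq E(B)$ and $B\subseteq E(A)$ for some $E\in\mathcal{E}$. Two subsets $A,B\subseteq X$ are asymptotically disjoint if whenever $L_1\subseteq A$, $L_2\subseteq B$ and $L_1\lambda_{\mathcal{E}}L_2$, then $L_1$ and $L_2$ are bounded. For $E\in\mathcal{E}$, an $E$-chain from $a$ to $b$ is a finite sequence $a=x_0,\dots,x_n=b$ in $X$ with $(x_i,x_{i+1})\in E$ for all $i\in\{0,\dots,n-1\}$. For asymptotically disjoint $A,B\subseteq X$, a subset $C\subseteq X$ is an asymptotic cut between $A$ and $B$ if $C$ is asymptotically disjoint from both $A$ and $B$ and for each $E\in\mathcal{E}$ there exists $F\in\mathcal{E}$ such that each $E$-chain from an element of $A$ to an element of $B$ meets $F(C)$. The asymptotic dimensiongrad $\operatorname{asDg}_{\mathcal{E}}(X)$ is defined inductively: $\operatorname{asDg}_{\mathcal{E}}(X)=-1$ (equivalently $\leq -1$) if and only if $X$ is bounded. For an integer $n\geq 0$, $\operatorname{asDg}_{\mathcal{E}}(X)\leq n$ if for each two asymptotically disjoint subsets $A$ and $B$ of $X$ there exists an asymptotic cut $C$ between $A$ and $B$ with $\operatorname{asDg}_{\mathcal{E}_C}(C)\leq n-1$. For $n\geq 0$, $\operatorname{asDg}_{\mathcal{E}}(X)=n$ if $\operatorname{asDg}_{\mathcal{E}}(X)\leq n$ holds and $\operatorname{asDg}_{\mathcal{E}}(X)\leq n-1$ does not hold. If $\operatorname{asDg}_{\mathcal{E}}(X)\leq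 n$ holds for no $n$, the asymptotic dimensiongrad is infinite. *)

(* Defs.v *)
From HB Require Import structures.
From mathcomp Require Import all_boot all_order all_algebra.
From mathcomp Require Import boolp classical_sets constructive_ereal.

Set Implicit Arguments.
Unset Strict Implicit.
Unset Printing Implicit Defensive.

Import Order.TTheory GRing.Theory Num.Theory.

Local Open Scope classical_set_scope.

(* The carrier is not required to be inhabited, so that every subset C,
   including the empty one, carries the induced structure. *)
Record coarse_structure (X : Type) := CoarseStructure {
  controlled :> set (X * X) -> Prop;
  controlled_sub : forall E F, controlled F -> E `<=` F -> controlled E;
  controlledU : forall E F,
    controlled E -> controlled F -> controlled (E `|` F);
  controlledV : forall E, controlled E -> controlled (E^-1)%relation;
  controlled_comp : forall E F,
    controlled E -> controlled F -> controlled (E \; F)%relation;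
  controlled_diag : controlled diagonal;
  controlled1 : forall x y, controlled [set (x, y)] }.

Definition bounded (X : Type) (E : coarse_structure X) (B : set X) : Prop :=
  E (B `*` B).

Section Induced.
Variables (X : Type) (E : coarse_structure X) (Y : set X).

(* The sets D `&` (Y `*` Y), D controlled, as relations on the type Y. *)
Definition induced_controlled : set (set (Y * Y)) :=
  [set F | exists2 D, E D & F = [set p | D (val p.1, val p.2)]].

Let induced_of (F : set (Y * Y)) :
  E [set (val p.1, val p.2) | p in F] -> induced_controlled F.
Proof.
move=> EF; exists [set (val p.1, val p.2) | p in F] => //.
apply/seteqP; split=> [p Fp | [a b] /= [[c d] Fcd [/val_inj ca /val_inj db]]].
  by exists p.
by rewrite -ca -db.
Qed.

Let of_induced (F : set (Y * Y)) :
  induced_controlled F -> E [set (val p.1, val p.2) | p in F].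
Proof.
move=> [D ED ->]; apply: (controlled_sub ED) => _ [[a b] /= Dab <-] //.
Qed.

Let induced_sub F G :
  induced_controlled G -> F `<=` G -> induced_controlled F.
Proof.
move=> /of_induced EG FG; apply: induced_of; apply: (controlled_sub EG).
by move=> _ [p Fp <-]; exists p => //; exact: FG.
Qed.

Let inducedU F G : induced_controlled F -> induced_controlled G ->
  induced_controlled (F `|` G).
Proof.
move=> [D ED ->] [D' ED' ->].
by exists (D `|` D') => //; exact: controlledU.
Qed.

Let inducedV F : induced_controlled F -> induced_controlled (F^-1)%relation.
Proof.
by move=> [D ED ->]; exists (D^-1)%relation => //; exact: controlledV.
Qed.

Let induced_comp F G : induced_controlled F -> induced_controlled G ->
  induced_controlled (F \; G)%relation.
Proof.
move=> [D ED ->] [D' ED' ->]; apply: induced_of.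
apply: (controlled_sub (controlled_comp ED ED')).
by move=> _ [[a b] [/= z D'az Dzb] <-]; exists (val z).
Qed.

Let induced_diag : induced_controlled diagonal.
Proof.
apply: induced_of; apply: (controlled_sub (controlled_diag E)).
by move=> _ [[a b] ab <-] /=; rewrite /diagonal /= in ab *; rewrite ab.
Qed.

Let induced1 x y : induced_controlled [set (x, y)].
Proof.
apply: induced_of; apply: (controlled_sub (controlled1 E (val x) (val y))).
by move=> _ [_ -> <-].
Qed.

Definition induced : coarse_structure Y :=
  CoarseStructure induced_sub inducedU inducedV induced_comp induced_diag
    induced1.

End Induced.

Section CoarseMaps.
Variables (X Y : Type) (E : coarse_structure X) (F : coarse_structure Y).

Definition coarse_map (f : X -> Y) : Prop :=
  (forall D, E D -> F [set (f p.1, f p.2) | p in D]) /\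
  (forall B, bounded F B -> bounded E (f @^-1` B)).

End CoarseMaps.

Definition coarse_equivalence (X Y : Type) (E : coarse_structure X)
    (F : coarse_structure Y) (f : X -> Y) : Prop :=
  coarse_map E F f /\
  exists g : Y -> X, [/\ coarse_map F E g,
    E [set (g (f x), x) | x in setT] &
    F [set (f (g y), y) | y in setT]].

Definition coarsely_equivalent (X Y : Type) (E : coarse_structure X)
    (F : coarse_structure Y) : Prop :=
  exists f : X -> Y, coarse_equivalence E F f.

(* For a relation D, the set written D(A). *)
Definition thicken (X : Type) (D : set (X * X)) (A : set X) : set X :=
  [set y | exists2 x, A x & D (y, x)].

Definition asym_close (X : Type) (E : coarse_structure X) (A B : set X) :=
  exists D, [/\ E D, A `<=` thicken D B & B `<=` thicken D A].

Definition asym_disjoint (X : Type) (E : coarse_structure X) (A B : set X) :=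
  forall L1 L2 : set X, L1 `<=` A -> L2 `<=` B -> asym_close E L1 L2 ->
    bounded E L1 /\ bounded E L2.

(* x 0, ..., x n is a D-chain from a to b; x m is irrelevant for n < m. *)
Definition is_chain (X : Type) (D : set (X * X)) (a b : X) (n : nat)
    (x : nat -> X) : Prop :=
  [/\ x 0 = a, x n = b & forall i, i < n -> D (x i, x i.+1)].

Definition asym_cut (X : Type) (E : coarse_structure X) (A B C : set X) :=
  [/\ asym_disjoint E C A, asym_disjoint E C B &
    forall D, E D -> exists2 F, E F &
      forall (a b : X) (n : nat) (x : nat -> X), A a -> B b ->
        is_chain D a b n x -> exists2 i, i <= n & thicken F C (x i)].

(* asDg_lt k E reads asDg < k, that is asDg <= k - 1. *)
Fixpoint asDg_lt (k : nat) (X : Type) (E : coarse_structure X) : Prop :=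
  if k is n.+1 then
    forall A B : set X, asym_disjoint E A B ->
      exists2 C : set X, asym_cut E A B C & asDg_lt n (induced E C)
  else bounded E setT.

(* k - 1 for the least k with asDg < k, and +oo if there is none; see asDg_eqN1,
   asDg_eqn and asDg_eqy. *)
Definition asDg (X : Type) (E : coarse_structure X) : \bar int :=
  if pselect (exists k, `[< asDg_lt k E >]) is left h
  then EFin ((ex_minn h)%:Z - 1)%R else +oo%E.

Lemma asDg_ltS (k : nat) (X : Type) (E : coarse_structure X) :
  asDg_lt k E -> asDg_lt k.+1 E.
Proof.
elim: k X E => [|k IHk] X E.
  move=> bX A B _.
  have bS (L : set X) : bounded E L by apply: (controlled_sub bX) => -[].
  exists setT; first split; do ?by move=> *; split; exact: bS.
    move=> D _; exists (setT `*` setT) => // a b n x _ _ _.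
    by exists 0 => //; exists a.
  by exists (setT `*` setT).
move=> lt A B /lt [C cutC ltC].
by exists C => //; exact: IHk.
Qed.

Lemma asDg_lt_le (k m : nat) (X : Type) (E : coarse_structure X) :
  k <= m -> asDg_lt k E -> asDg_lt m E.
Proof.
move=> /subnK <-; elim: (m - k) => // j IHj lt.
by rewrite addSn; apply: asDg_ltS; exact: IHj.
Qed.

Lemma asDg_eqN1 (X : Type) (E : coarse_structure X) :
  asDg E = EFin (-1)%R <-> bounded E setT.
Proof.
rewrite /asDg; case: pselect => [h|nh]; last first.
  by split=> // b; case: nh; exists 0; exact/asboolP.
case: ex_minnP => -[|k] /asboolP lt minh; first by [].
split=> [[/eqP]|b]; first by rewrite subr_eq addNr.
by have := minh 0 (asboolT (b : asDg_lt 0 E)).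
Qed.

Lemma asDg_eqn (X : Type) (E : coarse_structure X) (n : nat) :
  asDg E = EFin n%:Z%R <-> asDg_lt n.+1 E /\ ~ asDg_lt n E.
Proof.
rewrite /asDg; case: pselect => [h|nh]; last first.
  by split=> // -[lt _]; case: nh; exists n.+1; exact/asboolP.
case: ex_minnP => k /asboolP lt minh; split=> [[/eqP]|[ltS ltN]].
  rewrite subr_eq -PoszD addn1 => /eqP [kE]; rewrite -kE; split=> //.
  by move=> /asboolT /minh; rewrite kE ltnn.
have -> : k = n.+1; last by rewrite -addn1 PoszD addrK.
apply/eqP; rewrite eqn_leq minh /=; last exact/asboolP.
by rewrite ltnNge; apply/negP => kn; apply: ltN; exact: asDg_lt_le lt.
Qed.

Lemma asDg_eqy (X : Type) (E : coarse_structure X) :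
  asDg E = +oo%E <-> forall k, ~ asDg_lt k E.
Proof.
rewrite /asDg; case: pselect => [h|nh]; last first.
  by split=> // _ k lt; apply: nh; exists k; exact/asboolP.
by split=> // nlt; have [k /asboolP /(nlt k)] := h.
Qed.

(* Main.v *)
Require Import Defs.
From mathcomp Require Import all_boot all_order all_algebra.
From mathcomp Require Import boolp classical_sets constructive_ereal.

(** A coarse equivalence f : X -> Y is replaced by the relation "f x is close to
  y", which is total on both sides and carries controlled sets to controlled
  sets in both directions. Such relations are symmetric and restrict to
  C and R(C) for every subset C of X, without choosing maps.
  Disjoint A, B in Y are pulled back along R, a cut C of the pullbacks is pushed
  forward to R(C), and a chain in Y is lifted pointwise to a chain in X. *)

Set Implicit Arguments.
Unset Strict Implicit.
Unset Printing Implicit Defensive.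

Local Open Scope classical_set_scope.

Definition rel_image (X Y : Type) (R : X -> Y -> Prop) (A : set X) : set Y :=
  [set y | exists2 x, A x & R x y].

(** The relational analogue of (f × f)(D): the composite of the converse of [R], then [D], then
    [R]. *)
Definition transport (X Y : Type) (R : X -> Y -> Prop) (D : set (X * X)) :
    set (Y * Y) :=
  [set q | exists p, [/\ D p, R p.1 q.1 & R p.2 q.2]].

Record coarse_correspondence (X Y : Type) (E : coarse_structure X)
    (F : coarse_structure Y) (R : X -> Y -> Prop) : Prop := {
  corr_total : forall x, exists y, R x y;
  corr_surj : forall y, exists x, R x y;
  corr_transport : forall D, E D -> F (transport R D);
  corr_transportV : forall D, F D -> E (transport (fun y x => R x y) D) }.

Lemma corr_sym (X Y : Type) (E : coarse_structure X) (F : coarse_structure Y)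
    (R : X -> Y -> Prop) :
  coarse_correspondence E F R -> coarse_correspondence F E (fun y x => R x y).
Proof. by case=> tot surj tr trV; split. Qed.

Lemma corr_of_coarse_equivalence (X Y : Type) (E : coarse_structure X)
    (F : coarse_structure Y) (f : X -> Y) :
  coarse_equivalence E F f -> exists R, coarse_correspondence E F R.
Proof.
move=> [[fE _] [g [[gF _] gfE fgF]]].
(* The diagonal relates [x] to [f x], which gives totality; the pairs (f (g y), y) give
   surjectivity. *)
pose F0 := [set (f (g y), y) | y in setT] `|` diagonal.
have F0F : F F0 by apply: controlledU => //; exact: controlled_diag.
exists (fun x y => F0 (f x, y)); split.
- by move=> x; exists (f x); right.
- by move=> y; exists (g y); left; exists y.
- move=> D /fE DF.
  (* A transported pair (y, y') factors through y, f x, f x', y'. *)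
  apply: (controlled_sub
    (controlled_comp (controlled_comp F0F DF) (controlledV F0F))).
  move=> [y y'] [[x x'] [Dxx' xy x'y']].
  by exists (f x) => //; exists (f x') => //; exists (x, x').
- move=> D DF.
  (* The pair (f x, f x') factors through y, y'; [g] carries it to X, where g (f x) is close to
     x. *)
  have /gF D'E := controlled_comp (controlled_comp (controlledV F0F) DF) F0F.
  apply: (controlled_sub
    (controlled_comp (controlled_comp gfE D'E) (controlledV gfE))).
  move=> [x x'] [[y y'] [Dyy' xy x'y']].
  exists (g (f x)); first by exists x.
  exists (g (f x')); last by exists x'.
  exists (f x, f x') => //.
  by exists y => //; exists y'.
Qed.

(** A quasi-inverse of a map f need not send f(C) back into C, whereas every point of
    [rel_image R C] is related to a point of [C] by definition. *)
Lemma corr_induced (X Y : Type) (E : coarse_structure X)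
    (F : coarse_structure Y) (R : X -> Y -> Prop) (C : set X) :
  coarse_correspondence E F R ->
  coarse_correspondence (induced E C) (induced F (rel_image R C))
    (fun x y => R (val x) (val y)).
Proof.
move=> [tot surj tr trV]; split.
- move=> x; have [y xy] := tot (val x).
  have Cy : y \in rel_image R C.
    by apply/mem_set; exists (val x) => //; exact/set_mem/valP.
  by exists (SigSub Cy).
- move=> y; have [x Cx xy] := set_mem (valP y).
  by exists (SigSub (mem_set Cx)).
- move=> _ [D ED ->].
  apply: (@controlled_sub _ (induced F (rel_image R C)) _
    [set p | transport R D (val p.1, val p.2)]).
    by exists (transport R D) => //; exact: tr.
  by move=> [y y'] [[x x'] [? ? ?]]; exists (val x, val x').
- move=> _ [D FD ->].
  apply: (@controlled_sub _ (induced E C) _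
    [set p | transport (fun y x => R x y) D (val p.1, val p.2)]).
    by exists (transport (fun y x => R x y) D) => //; exact: trV.
  by move=> [x x'] [[y y'] [? ? ?]]; exists (val y, val y').
Qed.

Lemma asym_disjoint_sub (X : Type) (E : coarse_structure X)
    (A A' B B' : set X) :
  A' `<=` A -> B' `<=` B -> asym_disjoint E A B -> asym_disjoint E A' B'.
Proof.
move=> A'A B'B AB L1 L2 L1A' L2B'; apply: AB.
  exact: subset_trans A'A.
exact: subset_trans B'B.
Qed.

Section Correspondence.
Variables (X Y : Type) (E : coarse_structure X) (F : coarse_structure Y).
Variable R : X -> Y -> Prop.
Hypothesis corrR : coarse_correspondence E F R.

(** The square of [B'] lies in the transport of the square of [B]. *)
Lemma corr_bounded (B : set X) (B' : set Y) :
  B' `<=` rel_image R B -> bounded E B -> bounded F B'.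
Proof.
move=> B'B /(corr_transport corrR) bB; apply: (controlled_sub bB).
by move=> [y y'] [/B'B [x Bx xy] /B'B [x' Bx' xy']]; exists (x, x').
Qed.

Lemma corr_thicken (A B : set X) (L : set Y) (D : set (Y * Y)) (M : set Y) :
  L `<=` thicken D M -> M `<=` rel_image R B ->
  A `&` rel_image (fun y x => R x y) L `<=`
  thicken (transport (fun y x => R x y) D)
    (B `&` rel_image (fun y x => R x y) M).
Proof.
move=> LM MB x [_ [y /LM [y' My' Dyy'] xy]].
have [x' Bx' x'y'] := MB _ My'.
by exists x'; [split=> //; exists y' | exists (y, y')].
Qed.

Lemma corr_asym_disjoint (A B : set X) :
  asym_disjoint E A B -> asym_disjoint F (rel_image R A) (rel_image R B).
Proof.
move=> AB L1 L2 L1A L2B [D [FD L12 L21]].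
(* Intersecting with [S] keeps the lift inside [A] or [B]; since [L1] and [L2] lie in the images of
   [A] and [B], the lifts still map onto supersets of them, so boundedness descends. *)
pose lift S L := S `&` rel_image (fun y x => R x y) L.
have [] := AB (lift A L1) (lift B L2).
- by move=> x [].
- by move=> x [].
- exists (transport (fun y x => R x y) D); split.
  + exact: (corr_transportV corrR).
  + exact: corr_thicken.
  + exact: corr_thicken.
- move=> b1 b2; split.
  + apply: corr_bounded b1 => y L1y; have [x Ax xy] := L1A _ L1y.
    by exists x => //; split=> //; exists y.
  + apply: corr_bounded b2 => y L2y; have [x Bx xy] := L2B _ L2y.
    by exists x => //; split=> //; exists y.
Qed.

Lemma corr_asym_cut (A B : set Y) (C : set X) :
  asym_cut E (rel_image (fun y x => R x y) A)
    (rel_image (fun y x => R x y) B) C ->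
  asym_cut F A B (rel_image R C).
Proof.
have sub (S : set Y) : S `<=` rel_image R (rel_image (fun y x => R x y) S).
  by move=> y Sy; have [x xy] := corr_surj corrR y; exists x => //; exists y.
move=> [CA CB cutC]; split.
- exact: asym_disjoint_sub (subset_refl _) (sub A) (corr_asym_disjoint CA).
- exact: asym_disjoint_sub (subset_refl _) (sub B) (corr_asym_disjoint CB).
move=> D /(corr_transportV corrR) /cutC [G EG meetG].
exists (transport R G); first exact: (corr_transport corrR).
move=> a b n y Aa Bb [y0 yn ychain].
(* An arbitrary section of [R] suffices: consecutive points of the lifted chain lie in the transport
   of [D]. *)
have [s sy] := choice (corr_surj corrR).
have [|||i lein [c Cc Gxc]] := meetG (s a) (s b) n (s \o y).
- by exists a.
- by exists b.
- split=> [||i /ychain Dyy]; [by rewrite /= y0 | by rewrite /= yn |].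
  by exists (y i, y i.+1); split=> //; exact: sy.
exists i => //; have [z cz] := corr_total corrR c.
by exists z; [exists c | exists (s (y i), c); split=> //; exact: sy].
Qed.

End Correspondence.

Lemma corr_asDg_lt (k : nat) (X Y : Type) (E : coarse_structure X)
    (F : coarse_structure Y) (R : X -> Y -> Prop) :
  coarse_correspondence E F R -> asDg_lt k E -> asDg_lt k F.
Proof.
elim: k X Y E F R => [|k IHk] X Y E F R corrR /=.
  apply: (corr_bounded corrR) => y _.
  by have [x xy] := corr_surj corrR y; exists x.
move=> ltE A B /(corr_asym_disjoint (corr_sym corrR)) /ltE [C cutC ltC].
exists (rel_image R C); first exact: corr_asym_cut cutC.
exact: IHk (corr_induced C corrR) ltC.
Qed.

Lemma eq_asDg (X Y : Type) (E : coarse_structure X) (F : coarse_structure Y) :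
  (forall k, asDg_lt k E <-> asDg_lt k F) -> asDg E = asDg F.
Proof.
move=> EF.
(* [ex_minn] takes an existence proof, so the value is written as a function of the predicate alone
   before the two predicates are identified. *)
pose d (P : pred nat) : \bar int := if pselect (exists k, P k) is left h
  then EFin ((ex_minn h)%:Z - 1)%R else +oo%E.
apply: (congr1 d (x := fun k => `[< asDg_lt k E >])).
by apply/funext => k; exact/asbool_equiv_eq.
Qed.

Theorem proposition4p18 (X Y : Type) (E : coarse_structure X)
    (F : coarse_structure Y) (X0 : ([set: X] !=set0)%classic)
    (Y0 : ([set: Y] !=set0)%classic) (XY : coarsely_equivalent E F) :
  asDg E = asDg F.
Proof.
have [f /corr_of_coarse_equivalence [R corrR]] := XY.
apply: eq_asDg => k; split; apply: corr_asDg_lt; first exact: corrR.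
exact: corr_sym corrR.
Qed.
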